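(* Let $K\ge 2$, let $(\mathcal{X},\Pr)$ be a probability space of inputs, and let $\mathbf{z}:\mathcal{X}\to\mathbb{R}^K$ (teacher logits) and $\widehat{\Delta}:\mathcal{X}\to\mathbb{R}^K$ (penalty) be measurable functions such that $\mathbf{z}(\mathbf{x})$ has a unique maximal coordinate for every $\mathbf{x}\in\mathcal{X}$. For a temperature $\tau>0$, let $\lambda^\ast_\tau(\mathbf{x})$ denote the flip threshold of $\mathbf{x}$ when the teacher is served at temperature $\tau$, i.e. when its logits $\mathbf{z}(\mathbf{x})$ are replaced by $\mathbf{z}(\mathbf{x})/\tau$ while $\widehat{\Delta}(\mathbf{x})$ is unchanged, and let $F_\tau(\lambda) = \Pr[\lambda^\ast_\tau(\mathbf{x})\le\lambda]$; write $\lambda^\ast=\lambda^\ast_1$ and $F = F_1$. Then for every $\tau>0$, every flip threshold is divided by exactly $\tau$, that is $\lambda^\ast_\tau(\mathbf{x}) = \lambda^\ast(\mathbf{x})/\tau$ for all $\mathbf{x}\in\mathcal{X}$ (with $+\infty/\tau=+\infty$), and for every real $\lambda\ge 0$, $$F_\tau(\lambda) = F(\tau\lambda).$$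
   Context: Flip threshold: given logits $\mathbf{z}\in\mathbb{R}^K$ with unique top class $t=\arg\max_k z_k$ and a penalty vector $\widehat{\Delta}\in\mathbb{R}^K$, set $c_j = \widehat{\Delta}_j - \widehat{\Delta}_t$ for $j\ne t$. The flip threshold is $$\lambda^\ast = \min_{j\ne t:\, c_j>0} \frac{z_t - z_j}{c_j},$$ with $\lambda^\ast=+\infty$ when no $j\neq t$ satisfies $c_j>0$. It is the strength beyond which the top class of the served vector $\sigma(\log\sigma(\mathbf{z})+\lambda\widehat{\Delta})$ is no longer $t$, where $\sigma$ is the softmax. For temperature $\tau$, $\lambda^\ast_\tau(\mathbf{x})$ is this quantity computed with logits $\mathbf{z}(\mathbf{x})/\tau$ and penalty $\widehat{\Delta}(\mathbf{x})$. The probability $\Pr$ is over the inputs $\mathbf{x}$ (in the paper, the evaluation set). *)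

(* Defs.v *)
From HB Require Import structures.
From mathcomp Require Import all_boot all_order all_algebra.
From mathcomp Require Import all_classical all_reals all_analysis.

Set Implicit Arguments.
Unset Strict Implicit.
Unset Printing Implicit Defensive.

Import Order.TTheory GRing.Theory Num.Theory.
Import numFieldNormedType.Exports.

Local Open Scope classical_set_scope.
Local Open Scope ring_scope.

(* Vectors of R^K are K-tuples, because [K.-tuple R] carries the library's
   product sigma-algebra; on R^K this is the Borel sigma-algebra. *)

Definition is_argmax (R : realType) (K : nat) (z : K.-tuple R) (t : 'I_K)
  : bool := [forall k, tnth z k <= tnth z t].

Definition unique_top (R : realType) (K : nat) (z : K.-tuple R) : Prop :=
  exists! t : 'I_K, is_argmax z t.

(* [None] occurs only for K = 0; the choice among several maximal coordinates
   is arbitrary, and there is none to make under [unique_top z]. *)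
Definition top_class (R : realType) (K : nat) (z : K.-tuple R)
  : option 'I_K := [pick t | is_argmax z t].

(* The neutral element +oo of the minimum is the value of the threshold when
   no class j != t has a positive penalty gap c_j = delta_j - delta_t. *)
Definition flip_threshold (R : realType) (K : nat) (z delta : K.-tuple R)
  : \bar R :=
  if top_class z is Some t then
    \big[mine/+oo%E]_(j < K | (j != t) && (0 < tnth delta j - tnth delta t))
      ((tnth z t - tnth z j) / (tnth delta j - tnth delta t))%:E
  else +oo%E.

Definition temper (R : realType) (K : nat) (tau : R) (z : K.-tuple R)
  : K.-tuple R := [tuple tnth z k / tau | k < K].

Definition threshold_at (R : realType) (K : nat) (X : Type)
    (z delta : X -> K.-tuple R) (tau : R) (x : X) : \bar R :=
  flip_threshold (temper tau (z x)) (delta x).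

Definition threshold_cdf (R : realType) (K : nat) (d : measure_display)
    (X : measurableType d) (P : probability X R) (z delta : X -> K.-tuple R)
    (tau lambda : R) : \bar R :=
  P [set x | (threshold_at z delta tau x <= lambda%:E)%E].

(* Main.v *)
Require Import Defs.
From HB Require Import structures.
From mathcomp Require Import all_boot all_order all_algebra.
From mathcomp Require Import all_classical all_reals all_analysis.

Import Order.TTheory GRing.Theory Num.Theory.
Import numFieldNormedType.Exports.

Local Open Scope classical_set_scope.
Local Open Scope ring_scope.

(** Dividing the logits by [tau > 0] keeps their order, hence the top class [t]; the penalty gaps
    [c_j] are untouched, so the minimum runs over the same classes and each quotient
    [(z_t - z_j) / c_j] is divided by [tau]. Positive scaling commutes with minima and fixes [+oo],
    which gives [flip_threshold_temper]. The claim on distributions follows pointwise, by clearing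
    the denominator [tau] in the inequality that defines the event. *)

Lemma temperE (R : realType) (K : nat) (tau : R) (z : K.-tuple R) (k : 'I_K) :
  tnth (temper tau z) k = tnth z k / tau.
Proof. by rewrite tnth_mktuple. Qed.

(** Each comparison of logits survives positive scaling, so [pick] sees the same predicate and makes
    the same choice, even among ties. *)
Lemma top_class_temper (R : realType) (K : nat) (tau : R) (z : K.-tuple R) :
  0 < tau -> top_class (temper tau z) = top_class z.
Proof.
move=> tau_gt0; apply: eq_pick => t; apply: eq_forallb => k.
by rewrite !temperE ler_pM2r ?invr_gt0.
Qed.

Lemma temper1 (R : realType) (K : nat) (z : K.-tuple R) : temper 1 z = z.
Proof. by apply: eq_from_tnth => k; rewrite temperE divr1. Qed.

Lemma flip_threshold_temper (R : realType) (K : nat) (tau : R)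
    (z delta : K.-tuple R) :
  0 < tau ->
  flip_threshold (temper tau z) delta = (flip_threshold z delta / tau%:E)%E.
Proof.
move=> tau_gt0; rewrite /flip_threshold top_class_temper//.
have tauV_gt0 : 0 < tau^-1 by rewrite invr_gt0.
(* Positivity discards the [tau = 0] branch of the extended inverse. *)
rewrite inver gt_eqF//.
case: (top_class z) => [t|]; last by rewrite gt0_mulye ?lte_fin.
(* Scaling by [tau^-1] is a morphism for [mine] with neutral element [+oo], so it passes inside the
   minimum, an empty one included. *)
rewrite (big_morph (fun x => x * tau^-1%:E)%E (id1 := +oo%E) (op1 := mine)).
- apply: eq_bigr => j _; rewrite !temperE -EFinM -mulrBl; congr (_%:E).
  by rewrite mulrAC.
- by move=> x y; rewrite mine_pMl ?lee_fin ?ltW.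
- by rewrite gt0_mulye ?lte_fin.
Qed.

Lemma threshold_at_temper (R : realType) (K : nat) (X : Type)
    (z delta : X -> K.-tuple R) (tau : R) (x : X) :
  0 < tau ->
  threshold_at z delta tau x = (threshold_at z delta 1 x / tau%:E)%E.
Proof.
by move=> tau_gt0; rewrite /threshold_at temper1 flip_threshold_temper.
Qed.

Theorem mainTheorem2 (R : realType) (K : nat) (K_ge2 : (2 <= K)%N)
    (d : measure_display) (X : measurableType d) (P : probability X R)
    (z delta : X -> K.-tuple R)
    (z_meas : measurable_fun [set: X] z)
    (delta_meas : measurable_fun [set: X] delta)
    (z_top : forall x : X, unique_top (z x))
    (tau : R) (tau_gt0 : 0 < tau) :
  (forall x : X,
     threshold_at z delta tau x = (threshold_at z delta 1 x / tau%:E)%E) /\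
  (forall lambda : R, 0 <= lambda ->
     threshold_cdf P z delta tau lambda
     = threshold_cdf P z delta 1 (tau * lambda)).
Proof.
split=> [x|lambda _]; first exact: threshold_at_temper.
(* The two events are equal as sets, not merely in probability. *)
rewrite /threshold_cdf; congr (P _); apply/funext => x; apply/propext => /=.
by rewrite threshold_at_temper// inver gt_eqF// lee_pdivrMr// -EFinM mulrC.
Qed.
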